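(* Let $n\ge 3$ be an odd natural number, let $d,R\in\mathbb{Q}$ with $d\neq 0$ and $R$ not a square in $\mathbb{Q}$, and put $D=d^2-R$. Write $R=s^2R'$ with $s\in\mathbb{Q}$ and $R'\in\mathbb{Z}$ square-free. Let $L\subseteq\mathbb{C}$ be the splitting field over $\mathbb{Q}$ of $f_n=f_n(Z,d,R)$, and let $\zeta_n$ be a primitive $n$th root of unity. Suppose that $f_n$ is irreducible in $\mathbb{Q}[Z]$, and that $R'\neq -3$ if $3\mid n$. Then $\mathrm{Gal}(L/\mathbb{Q})$ is isomorphic to a semidirect product $$(\mathbb{Z}/n\mathbb{Z})\rtimes(\mathbb{Z}/n\mathbb{Z})^{\times},$$ except in the case $R'<0$ and $\sqrt{R'}\in\mathbb{Q}(\zeta_n)$, where $\mathrm{Gal}(L/\mathbb{Q})$ is isomorphic to a semidirect product $$(\mathbb{Z}/n\mathbb{Z})\rtimes\big((\mathbb{Z}/n\mathbb{Z})^{\times}/\{\pm1\}\big).$$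
   Context: For an integer $k\ge 1$ let $F_k\in\mathbb{Z}[Z]$ be the polynomial $F_k=\sum_{j=0}^{\lfloor k/2\rfloor}(-1)^j\frac{k}{k-j}\binom{k-j}{j}Z^{k-2j}$, i.e. $F_k(Z)=2T_k(Z/2)$ with $T_k$ the Chebyshev polynomial of the first kind; equivalently $2\cos(kx)=F_k(2\cos x)$ and $F_k(W+W^{-1})=W^k+W^{-k}$. For odd $n\ge3$, $d,R\in\mathbb{Q}$, $d\ne0$, $R$ not a square, $D=d^2-R$, the De Moivre polynomial is $$f_n(Z,d,R)=\sqrt D^{\,n}F_n(Z/\sqrt D)-2dD^{(n-1)/2}=\sum_{j=0}^{(n-1)/2}(-1)^j\frac{n}{n-j}\binom{n-j}{j}D^jZ^{n-2j}-2dD^{(n-1)/2}\in\mathbb{Q}[Z].$$ (If $y^n=d+\sqrt R$, $y'^n=d-\sqrt R$ and $z=yy'$, then $u=z^{(n-1)/2}(y+y')$ is a zero of $f_n$.) *)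

(* Defs.v *)
From HB Require Import structures.
From mathcomp Require Import all_boot all_order all_algebra all_fingroup all_solvable all_field.
Set Implicit Arguments. Unset Strict Implicit. Unset Printing Implicit Defensive.
Import Order.TTheory GRing.Theory Num.Theory.
Local Open Scope ring_scope.

Definition deMoivre_poly (n : nat) (d R : rat) : {poly rat} :=
  let D := d ^+ 2 - R in
  \sum_(j < (n.-1)./2.+1)
     ((-1) ^+ j * ((n%:R / (n - j)%:R) * ('C(n - j, j))%:R) * D ^+ j) *: 'X^(n - 2 * j)
  - (2 * d * D ^+ (n.-1)./2)%:P.

Definition sqfree_int (z : int) : Prop :=
  z != 0 /\ forall p : nat, prime p -> ~~ (p * p %| `|z|)%N.

(* sqrt(R') lies in Q(zeta_n) inside algC: Q(zeta_n) = {q(zeta_n) | q in Q[X]} *)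
Definition sqrt_in_cyclotomic (n : nat) (R' : int) : Prop :=
  exists z : algC, n.-primitive_root z /\
    exists q : {poly rat}, (map_poly ratr q).[z] = sqrtC (R'%:~R).

Definition pm1_units (n : nat) : {set {unit 'Z_n}} :=
  [set u : {unit 'Z_n} | (val u == 1) || (val u == -1)].

(* Main.v *)
Require Import Defs.
From HB Require Import structures.
From mathcomp Require Import all_boot all_order all_algebra all_fingroup all_solvable all_field.
From mathcomp Require Import ring zify.
Import Order.TTheory GRing.Theory Num.Theory.
Local Open Scope ring_scope.

(* Choose alpha with alpha^n = D^((n-1)/2) (d + sqrt R). The roots of f_n are
   u_a = alpha zeta^a + (D/alpha) zeta^(-a) for a in Z/n, and an automorphism
   with zeta |-> zeta^c and sqrt R |-> eps sqrt R acts on them by an affine map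
   a |-> (eps c) a + b. So the Galois group embeds in the affine group of Z/n,
   transitively since f_n is irreducible, and for every unit c it contains an
   element with multiplier c or -c.
   Suppose it misses some translation. Commutators are translations, so modulo
   some prime p | n the group is abelian, hence, being transitive, all its
   multipliers are 1 modulo p. As 2 or -2 is a multiplier, p = 3; but then
   eps c = 1 modulo 3 throughout, that is, sqrt R' * sqrt(-3) is fixed by all
   automorphisms, and R' = -3.
   So the group is the semidirect product of all translations with the
   stabiliser of 0, which is isomorphic to the group of multipliers. The latter
   is everything if it contains -1, and a complement of {1, -1} otherwise. It
   contains -1 through complex conjugation if R' > 0, and through an
   automorphism fixing zeta and moving sqrt R' if sqrt R' is not in Q(zeta). *)

(** * Groups of affine maps of Z/n *)

Section AffineGroup.

Variables (n : nat) (gT : finGroupType) (G : {group gT}).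
Variables (mu : {morphism G >-> {unit 'Z_n}}) (tr : gT -> 'Z_n).
Hypothesis n_gt1 : (1 < n)%N.
Hypothesis trM : {in G &, forall g h, tr (g * h)%g = tr g * val (mu h) + tr h}.
Hypothesis mu_tr_faithful : {in G, forall g, mu g = 1%g -> tr g = 0 -> g = 1%g}.
Hypothesis tr_trans : forall j, exists2 g, g \in G & tr g = j.

Lemma tr_kerM : {in ('ker mu)%g &, {morph tr : g h / (g * h)%g >-> (g * h)%g}}.
Proof.
move=> g h Kg Kh; rewrite trM ?(dom_ker Kg) ?(dom_ker Kh) //.
by rewrite (mker Kh) mulr1.
Qed.
Canonical tr_ker_morphism := Morphism tr_kerM.

Lemma tr_ker_inj : ('injm tr_ker_morphism)%g.
Proof.
apply/subsetP=> g Kg; have Kg' := dom_ker Kg; have := mker Kg; rewrite inE /=.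
move=> tg; apply/eqP; apply: mu_tr_faithful => //; first exact: dom_ker Kg'.
exact: mker Kg'.
Qed.

(* Commutators have multiplier 1, so their displacements are translations. *)
Lemma commutator_translation g h : g \in G -> h \in G ->
  (val (mu g) - 1) * tr h - (val (mu h) - 1) * tr g
    \in (tr_ker_morphism @* 'ker mu)%g.
Proof.
move=> Gg Gh; pose x := ((g * h)^-1 * (h * g))%g.
have Kx : x \in ('ker mu)%g.
  apply/kerP; rewrite ?(groupM, groupV) // !(morphM, morphV) ?(groupM, groupV) //.
  rewrite (centsP (units_Zp_abelian n) (mu h) _ (mu g)) ?inE //.
  by rewrite mulVg.
have -> : (val (mu g) - 1) * tr h - (val (mu h) - 1) * tr g = tr x.
  have: tr (g * h * x)%g = tr (h * g)%g by rewrite mulKVg.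
  rewrite (trM _ _ (groupM Gg Gh) (dom_ker Kx)) (mker Kx) mulr1 (trM g h) // (trM h g) // => e.
  have -> : tr x = tr h * val (mu g) + tr g - (tr g * val (mu h) + tr h).
    by rewrite -e addrC addKr.
  by ring.
exact: mem_morphim.
Qed.

(** Since [(n %/ p)%:R * y = 0] holds exactly when p divides y, this factor expresses congruence
    modulo p without leaving ['Z_n]. The two cases are x = 0 and x invertible in the field Z/p;
    Bezout gives the inverse, negated. *)
Lemma ann_divn_prime (p : nat) (x : 'Z_n) : prime p -> (p %| n)%N ->
  (n %/ p)%:R * x = 0 \/ exists j, (n %/ p)%:R * (x * j + 1) = 0.
Proof.
move=> p_pr p_n; have e0 : (n %/ p)%:R * p%:R = 0 :> 'Z_n.
  by rewrite -natrM divnK // pchar_Zp.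
case: (boolP (p %| x)%N) => [/dvdnP[q xq]|px].
  by left; rewrite -[x]natr_Zp xq natrM mulrCA e0 mulr0.
right; have x_gt0 : (0 < x)%N by case: (val x) px; rewrite ?dvdn0.
have co : coprime x p by rewrite coprime_sym prime_coprime.
case: (egcdnP p x_gt0) => km kn; rewrite (eqP co) => e _.
exists (- km%:R); rewrite mulrN -{1}[x]natr_Zp -natrM mulnC e natrD.
by rewrite opprD addrNK natrM mulrN mulrCA e0 mulr0 oppr0.
Qed.

Hypothesis n_odd : odd n.
Hypothesis mu_pm :
  forall c, c \is a GRing.unit -> exists2 g, g \in G & val (mu g) = c \/ val (mu g) = - c.
Hypothesis mu_mod3 : (3 %| n)%N ->
  exists2 g, g \in G & (n %/ 3)%:R * (val (mu g) - 1) != 0.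

Let natr_eq0 (m : nat) : (m%:R == 0 :> 'Z_n) = (n %| m)%N.
Proof. by rewrite -val_eqE /= val_Zp_nat. Qed.

Lemma all_translations : (tr_ker_morphism @* 'ker mu)%g = Zp n.
Proof.
have ZpT : Zp n = [set: 'Z_n] by rewrite /Zp n_gt1.
apply/eqP; rewrite ZpT eqEcard subsetT /= -ZpT card_Zp; last exact: ltnW.
pose S := (tr_ker_morphism @* 'ker mu)%G.
rewrite leqNgt; apply/negP=> S_lt; change (is_true (#|S| < n)%N) in S_lt.
have [m [m_gt0 m_lt m_n mS]] : exists m : nat,
  [/\ (0 < m)%N, (m < n)%N, (m %| n)%N & forall b, b \in S -> m%:R * b = 0].
  exists #|S|; split=> // [|b Sb]; last by rewrite mulr_natl -FinRing.zmodXgE expg_cardG.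
  have := @cardSg _ (Zp_group n) S.
  by rewrite /= card_Zp ?(ltnW n_gt1) //; apply; rewrite ZpT subsetT.
have q_gt1 : (1 < n %/ m)%N by rewrite ltn_divRL // mul1n.
(* As [p] divides the index [n %/ m], [m] divides [n %/ p]; hence [e] kills [S], that is, every
   translation in the group vanishes modulo p. *)
pose p := pdiv (n %/ m); have p_pr : prime p by apply: pdiv_prime.
have pm : (p * m %| n)%N by rewrite -(divnK m_n) dvdn_pmul2r // pdiv_dvd.
have p_n : (p %| n)%N by apply: dvdn_trans pm; apply: dvdn_mulr.
pose e : 'Z_n := (n %/ p)%:R.
have e_neq0 : e != 0.
  rewrite natr_eq0; apply/negP=> /dvdn_leq.
  by rewrite divn_gt0 ?prime_gt0 // dvdn_leq ?(ltnW n_gt1) // => /(_ isT);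
     rewrite leqNgt ltn_Pdiv ?prime_gt1 ?(ltnW n_gt1).
have eS b : b \in S -> e * b = 0.
  move=> Sb; have /dvdnP[k e_k] : (m %| n %/ p)%N by rewrite dvdn_divRL // mulnC.
  by rewrite /e e_k natrM -mulrA mS ?mulr0.
have comm0 g h : g \in G -> h \in G ->
  e * ((val (mu g) - 1) * tr h - (val (mu h) - 1) * tr g) = 0.
  by move=> Gg Gh; apply/eS/commutator_translation.
(* With [tr g1 = 1] the commutator relation reads (mu g1 - 1) tr h = mu h - 1 modulo p. If mu g1 - 1
   were invertible modulo p, some h with (mu g1 - 1) tr h = -1 would have a multiplier divisible by
   p, although multipliers are units. *)
have [g1 Gg1 tg1] := tr_trans 1.
have c1 : e * (val (mu g1) - 1) = 0.
  have [//|[j ej]] := ann_divn_prime p (val (mu g1) - 1) p_pr p_n.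
  have [gj Gj tj] := tr_trans j.
  have := comm0 _ _ Gg1 Gj; rewrite tg1 tj mulr1.
  have -> : (val (mu g1) - 1) * j - (val (mu gj) - 1) =
            ((val (mu g1) - 1) * j + 1) - val (mu gj) by ring.
  rewrite mulrBr ej sub0r => /eqP; rewrite oppr_eq0 => /eqP e0.
  by case/eqP: e_neq0; rewrite -[e](mulrK (valP (mu gj))) e0 mul0r.
have call g : g \in G -> e * (val (mu g) - 1) = 0.
  move=> Gg; have := comm0 _ _ Gg1 Gg; rewrite tg1 mulr1 mulrBr mulrA c1 mul0r sub0r.
  by move/eqP; rewrite oppr_eq0 => /eqP.
have u2 : (2%:R : 'Z_n) \is a GRing.unit by rewrite unitZpE // coprimen2.
have [g Gg [g2|g2]] := mu_pm _ u2; have := call _ Gg; rewrite g2.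
  by move/eqP; rewrite -[2%:R]/(1 + 1 : 'Z_n) addrK mulr1 (negPf e_neq0).
have -> : - 2%:R - 1 = - 3%:R :> 'Z_n by ring.
rewrite mulrN => /eqP; rewrite oppr_eq0 -natrM natr_eq0 => n3.
have p3 : p = 3%N.
  apply/eqP; rewrite -dvdn_prime2 //.
  move: n3; rewrite -{1}(divnK p_n) dvdn_pmul2l // divn_gt0 ?prime_gt0 //.
  by rewrite dvdn_leq ?(ltnW n_gt1).
rewrite p3 in p_n.
have [h Gh] := mu_mod3 p_n; have := call _ Gh.
by rewrite /e p3 => ->; rewrite eqxx.
Qed.

(** The kernel of [mu] is complemented by the stabiliser of 0: the former acts by translations, and
    since all translations occur, each element can be corrected by one so as to fix 0. *)
Lemma affine_sdprod : exists N H : {group gT},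
  [/\ (N ><| H)%g = G, (N \isog Zp n)%g & (H \isog mu @* G)%g].
Proof.
have trG1 : group_set [set g in G | tr g == 0].
  apply/group_setP; split=> [|g h]; first by rewrite inE group1 (morph1 tr_ker_morphism).
  rewrite !inE => /andP[Gg /eqP tg] /andP[Gh /eqP th].
  by rewrite groupM // trM // tg th mul0r addr0 eqxx.
pose H := Group trG1; pose N := ('ker mu)%G.
have sHG : H \subset G by apply/subsetP=> g; rewrite inE => /andP[].
have nNH : H \subset ('N(N))%g by apply: subset_trans sHG (ker_norm mu).
have tiNH : (N :&: H)%g = 1%g.
  apply/trivgP/subsetP=> g; rewrite !inE => /andP[/andP[Gg /eqP mg] /andP[_ /eqP tg]].
  by apply/eqP/mu_tr_faithful; rewrite ?mg.
have NH : (N ><| H)%g = G.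
  rewrite sdprodE //; apply/eqP; rewrite eqEsubset mul_subG ?subsetIl //=.
  apply/subsetP=> g Gg; have u := valP (mu g).
  (* The value solves tr x * mu g + tr g = 0, so that x g fixes 0. *)
  have : - (tr g / val (mu g)) \in (tr_ker_morphism @* 'ker mu)%g.
    by rewrite all_translations /Zp n_gt1 inE.
  case/morphimP=> x _ Kx /= tx; have Gx := dom_ker Kx.
  apply/mulsgP; exists x^-1%g (x * g)%g; rewrite ?groupV ?mulKg //.
  by rewrite inE groupM // trM // -tx mulNr divrK // addNr eqxx.
exists N, H; split=> //; last first.
  by apply: isog_trans (sdprod_isog NH) (first_isog mu).
apply/isogP; exists tr_ker_morphism; first exact: tr_ker_inj.
exact: all_translations.
Qed.

Lemma affine_sdprod_units : (exists2 g, g \in G & val (mu g) = -1) ->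
  exists N H : {group gT},
  [/\ (N ><| H)%g = G, (N \isog Zp n)%g & (H \isog units_Zp n)%g].
Proof.
case=> g1 Gg1 mg1; have [N [H [NH iN iH]]] := affine_sdprod.
exists N, H; split=> //; suff <- : (mu @* G)%g = units_Zp n by [].
apply/eqP; rewrite eqEsubset subsetT; apply/subsetP=> u _.
have [g Gg [mg|mg]] := mu_pm _ (valP u).
  by rewrite -(val_inj mg) mem_morphim.
have -> : u = mu (g * g1)%g.
  by apply: val_inj; rewrite morphM //= mg mg1 mulrN1 opprK.
by rewrite mem_morphim ?groupM.
Qed.

(** The multipliers meet {1, -1} trivially and together with it give all units, so they map
    isomorphically onto the quotient by {1, -1}. *)
Lemma affine_sdprod_units_mod_pm1 : ~ (exists2 g, g \in G & val (mu g) = -1) ->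
  exists N H : {group gT},
  [/\ (N ><| H)%g = G, (N \isog Zp n)%g & (H \isog units_Zp n / <<pm1_units n>>)%g].
Proof.
move=> noN1; have [N [H [NH iN iH]]] := affine_sdprod.
exists N, H; split=> //; apply: isog_trans iH _.
have gP : group_set (pm1_units n).
  apply/group_setP; split=> [|x y]; first by rewrite inE eqxx.
  rewrite !inE /= => /orP[]/eqP-> /orP[]/eqP->;
     by rewrite ?mulrN1 ?mulr1 ?opprK ?eqxx ?orbT.
pose P := Group gP; rewrite (genGid P).
suff PU : (P ><| mu @* G)%g = units_Zp n by apply: sdprod_isog PU.
rewrite sdprodE.
- apply/eqP; rewrite eqEsubset subsetT; apply/subsetP=> u _.
  have [g Gg [mg|mg]] := mu_pm _ (valP u).
    apply/mulsgP; exists 1%g (mu g); rewrite ?mem_morphim ?group1 // mul1g.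
    exact: val_inj.
  have uN1 : (-1 : 'Z_n) \is a GRing.unit by rewrite unitrN1.
  apply/mulsgP; exists (FinRing.unit 'Z_n uN1) (mu g); rewrite ?mem_morphim //.
    by rewrite inE /= eqxx orbT.
  by apply: val_inj; rewrite /= mg mulN1r opprK.
- by apply/cents_norm/(centSS _ _ (units_Zp_abelian n)); apply: subsetT.
apply/trivgP/subsetP=> u; rewrite !inE => /andP[Pu /morphimP[g _ Gg ug]].
case/orP: Pu => /eqP vu; first by apply/eqP/val_inj.
by case: noN1; exists g; rewrite // -ug.
Qed.

End AffineGroup.

(** * Automorphisms of number fields and of algC *)

(** By the primitive element theorem L = Q(x), and x can be sent to any complex root [w] of its
    minimal polynomial. *)
Lemma num_field_to_algC (L : fieldExtType rat) : inhabited {rmorphism L -> algC}.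
Proof.
have [x Lx] : exists x : L, fullv = <<1; x>>%VS.
  exists (separable_generator 1 {:L}); apply: eq_adjoin_separable_generator (sub1v _).
  apply/separableP=> y _; apply: pcharf0_separable.
  exact: ftrans (pchar_lalg L) (pchar_num _).
have /polyOver1P[p Dp] := minPolyOver 1 x.
have [w pw] : exists w : algC, root (map_poly ratr p) w.
  apply/closed_rootP; rewrite size_map_poly -(size_map_poly (in_alg L)) -Dp gtn_eqF //.
  by apply: root_size_gt1 (root_minPoly 1 x); rewrite monic_neq0 // monic_minPoly.
have ev q : root (map_poly (in_alg L) q) x -> (map_poly ratr q).[w] = 0.
  move=> qx; apply/rootP; apply: root_dvdp pw.
  rewrite dvdp_map -(dvdp_map (in_alg L)) -Dp minPoly_dvdp //.
  exact: alg_polyOver.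
(* This makes q(x) |-> q(w) independent of the polynomial q chosen for each element. *)
have eq_ev q1 q2 : (map_poly (in_alg L) q1).[x] = (map_poly (in_alg L) q2).[x] ->
    (map_poly ratr q1).[w] = (map_poly ratr q2).[w] :> algC.
  move=> q12; apply/eqP; rewrite -subr_eq0 -hornerN -hornerD -rmorphB /=.
  by apply/eqP/ev/rootP; rewrite rmorphB hornerD hornerN /= q12 subrr.
have pre y : {q : {poly rat} | y = (map_poly (in_alg L) q).[x]}.
  by apply/sig_eqW/Fadjoin1_polyP; rewrite -Lx memvf.
pose e y := (map_poly ratr (sval (pre y))).[w] : algC.
have eE q : e (map_poly (in_alg L) q).[x] = (map_poly ratr q).[w].
  by apply: eq_ev; rewrite /e; case: (pre _).
have ea : zmod_morphism e.
  move=> y1 y2; have [[q1 ->] [q2 ->]] := (pre y1, pre y2).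
  by rewrite -hornerN -hornerD -rmorphB /= !eE rmorphB /= hornerD hornerN.
have em : monoid_morphism e.
  split=> [|y1 y2].
    have -> : 1 = (map_poly (in_alg L) 1).[x] by rewrite rmorph1 hornerC.
    by rewrite eE rmorph1 hornerC.
  have [[q1 ->] [q2 ->]] := (pre y1, pre y2).
  by rewrite -hornerM -rmorphM /= !eE rmorphM /= hornerM.
pose eaM := GRing.isZmodMorphism.Build _ _ e ea.
pose emM := GRing.isMonoidMorphism.Build _ _ e em.
by exists; exact: (HB.pack e eaM emM : {rmorphism L -> algC}).
Qed.

(** If x lies outside Q(z), its minimal polynomial over Q(z) is X^2 - c, so x |-> -x defines an
    automorphism of Q(z, x) over Q(z), which extends to [algC]. *)
Lemma sqrt_fixed_by_auts (z x : algC) (c : rat) : x ^+ 2 = ratr c ->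
  (forall nu : {rmorphism algC -> algC}, nu z = z -> nu x = x) ->
  exists q : {poly rat}, (map_poly ratr q).[z] = x.
Proof.
move=> xc fix_x.
have [Qs [QsC [[|z1 [|x1 []]] // [Dz Dx] gen]]] := num_field_exists [:: z; x].
have [/Fadjoin1_polyP Kx|Kx] := boolP (x1 \in <<1; z1>>%VS).
  have [q Dq] := Kx.
  exists q; rewrite -Dx Dq -Dz -horner_map -map_poly_comp; congr _.[_].
  by apply: eq_map_poly => a; rewrite /= rmorphZ_num rmorph1 mulr1.
pose K := <<1; z1>>%AS; pose p := ('X - x1%:P) * ('X - (- x1)%:P).
have fullK : fullv = <<K; x1>>%VS by rewrite -gen adjoin_cons adjoin_seq1.
have Kx2 : x1 ^+ 2 \in K.
  apply: (subvP (sub1v K)); apply/vlineP; exists c.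
  by apply: (fmorph_inj QsC); rewrite rmorphXn /= Dx xc rmorphZ_num rmorph1 mulr1.
have pE : p = 'X^2 - (x1 ^+ 2)%:P by rewrite /p rmorphN rmorphXn; ring.
have Kp : p \is a polyOver K by rewrite pE rpredB ?rpredX ?polyOverX ?polyOverC.
have px : root p x1 by rewrite rootM root_XsubC eqxx.
have szp : size p = 3 by rewrite size_Mmonic ?monicXsubC ?polyXsubC_eq0 ?size_XsubC.
have p_min : minPoly K x1 %= p.
  rewrite -dvdp_size_eqp ?minPoly_dvdp // eqn_leq dvdp_leq ?minPoly_dvdp ?szp //=;
    last by rewrite -size_poly_gt0 szp.
  have := root_size_gt1 (monic_neq0 (monic_minPoly K x1)) (root_minPoly K x1).
  have := adjoin_deg_eq1 K x1; rewrite (negPf Kx) size_minPoly.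
  by case: (adjoin_degree K x1) => [|[]].
have homK : kHom K K (\1%VF : 'End(Qs)) by rewrite kHom1.
have rN : root (map_poly \1%VF (minPoly K x1)) (- x1).
  rewrite (kHom_poly_id homK) ?minPolyOver // (eqp_root p_min).
  by rewrite rootM !root_XsubC eqxx orbT.
pose phi := kHomExtend K \1 x1 (- x1).
have homphi : kHom K {:Qs} phi by rewrite fullK kHomExtendP.
have phim : monoid_morphism phi.
  exact/kHom_monoid_morphism/(kHomSl (sub1v K) homphi).
pose phimM := GRing.isMonoidMorphism.Build _ _ phi phim.
pose phiRM : {rmorphism _ -> _} := HB.pack (fun_of_lfun phi) phimM.
have [nu Dnu] := extend_algC_subfield_aut QsC phiRM.
have nuz : nu z = z.
  by rewrite -Dz -Dnu /= kHomExtend_id ?id_lfunE ?memv_adjoin.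
(* Now [nu] fixes z and negates x, so x = -x = 0, which does lie in Q(z). *)
have := fix_x nu nuz; rewrite -{1}Dx -Dnu /= (kHomExtend_val homK rN).
rewrite rmorphN /= Dx => /eqP; rewrite eq_sym -addr_eq0 -mulr2n mulrn_eq0 /= => /eqP x0.
by case/negP: Kx; rewrite (_ : x1 = 0) ?mem0v //; apply: (fmorph_inj QsC); rewrite Dx x0 rmorph0.
Qed.

Lemma gal_to_algC_aut (L : splittingFieldType rat) (e : {rmorphism L -> algC})
    (g : gal_of {:L}) :
  exists nu : {rmorphism algC -> algC}, forall y, nu (e y) = e (g y).
Proof.
by have [nu nuE] := extend_algC_subfield_aut e (gal_repr g); exists nu => y; rewrite -nuE.
Qed.

(** A splitting field is normal over Q, so the image of [e] is stable under [nu]. *)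
Lemma algC_aut_to_gal (L : splittingFieldType rat) (e : {rmorphism L -> algC})
    (nu : {rmorphism algC -> algC}) :
  exists2 g : gal_of {:L}, g \in 'Gal({:L} / 1)%g & forall y, nu (e y) = e (g y).
Proof.
have [f Df] := restrict_aut_to_normal_num_field e nu.
have homf : kHom 1 {:L} (linfun f).
  apply/kHom_monoid_morphism; split=> [|x y]; rewrite !lfunE /=.
    exact: rmorph1.
  exact: rmorphM.
have : kAut 1 {:L} (linfun f) by rewrite kAutfE.
case/kAut_to_gal=> g Gg fg; exists g => // y.
by rewrite -Df -fg ?memvf // lfunE.
Qed.

(** * The roots of De Moivre polynomials *)

Section Dickson.

Variables (K : comNzRingType) (s D : K).

(* Once [N] exceeds [m / 2] this is the Dickson polynomial of the second kind
   of degree [m], since the binomial then vanishes for [j >= N]. *)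
Definition dicksonU (N m : nat) : K :=
  \sum_(j < N) (-1) ^+ j * ('C(m - j, j))%:R * D ^+ j * s ^+ (m - 2 * j).

Lemma dicksonU0 N : dicksonU N.+1 0 = 1.
Proof.
rewrite /dicksonU big_ord_recl big1 /= => [|i _]; first by rewrite !mul1r addr0.
by rewrite bin_small ?mulr0 ?mul0r // sub0n.
Qed.

Lemma dicksonU1 N : dicksonU N.+1 1 = s.
Proof.
rewrite /dicksonU big_ord_recl big1 /= => [|i _]; first by rewrite !mul1r addr0.
by rewrite bin_small ?mulr0 ?mul0r //; lia.
Qed.

(** Pascal's rule, term by term. The last sum is one term shorter because its index j matches j + 1
    in the others. *)
Lemma dicksonUSS N m :
  dicksonU N.+1 m.+2 = s * dicksonU N.+1 m.+1 - D * dicksonU N m.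
Proof.
rewrite /dicksonU !big_ord_recl /= !bin0 !muln0 !subn0.
rewrite mulrDr -addrA [s ^+ m.+2]exprS; congr (_ + _); first by ring.
rewrite !mulr_sumr -sumrB.
apply: eq_bigr => i _; rewrite /bump !add1n.
have -> : (m.+2 - i.+1 = m.+1 - i)%N by lia.
have -> : (m.+1 - i.+1 = m - i)%N by lia.
have -> : (m.+2 - 2 * i.+1 = m - 2 * i)%N by lia.
have [le_im|lt_mi] := leqP i m; last first.
  by rewrite 3?bin_small; [ring | lia | lia | lia].
rewrite subSn // binS natrD.
(* For m <= 2 i the exponent [m.+1 - 2 * i.+1] is truncated to 0, but its binomial coefficient
   vanishes. *)
have [lt_im|le_mi] := ltnP (2 * i) m; last first.
  have -> : 'C(m - i, i.+1) = 0%N by apply: bin_small; lia.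
  by rewrite !exprS; ring.
have -> : (m - 2 * i = (m.+1 - 2 * i.+1).+1)%N by lia.
rewrite !exprS; ring.
Qed.

End Dickson.

Arguments dicksonU {K}.

(** Both sides satisfy t_(m+2) = (x + y) t_(m+1) - x y t_m. The bound on m ensures that neither sum
    is cut short. *)
Lemma dickson_power_sum (K : comNzRingType) (x y : K) (N m : nat) : (m < 2 * N)%N ->
  dicksonU (x + y) (x * y) N.+1 m.+2 - x * y * dicksonU (x + y) (x * y) N m
    = x ^+ m.+2 + y ^+ m.+2.
Proof.
elim/ltn_ind: m N => -[|[|m]] IH [|N] // ltmN.
- by rewrite dicksonUSS dicksonU1 dicksonU0; ring.
- by rewrite !dicksonUSS !dicksonU1 dicksonU0; ring.
have e1 := IH m.+1 (ltnSn _) N.+1 (ltnW ltmN).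
have e2 := IH m (ltnW (ltnSn _)) N (ltac:(lia)).
rewrite dicksonUSS [dicksonU _ _ N.+1 m.+2]dicksonUSS.
transitivity ((x + y) * (x ^+ m.+3 + y ^+ m.+3) - x * y * (x ^+ m.+2 + y ^+ m.+2)).
  rewrite -e1 -e2 [dicksonU _ _ N.+1 m.+2]dicksonUSS; ring.
by rewrite !exprS; ring.
Qed.

(** With n = m + 2 and j = i + 1, this is the absorption identity j C(n-j, j) = (n-j) C(n-j-1, j-1).
    The two binomials are the coefficients of the two Dickson sums in [dickson_power_sum]. *)
Lemma deMoivre_coefE (m i : nat) : (2 * i <= m)%N ->
  m.+2%:R / (m.+2 - i.+1)%:R * ('C(m.+2 - i.+1, i.+1))%:R
    = ('C(m.+2 - i.+1, i.+1) + 'C(m - i, i))%:R :> rat.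
Proof.
move=> le_im; have -> : (m.+2 - i.+1 = (m - i).+1)%N by lia.
have nz : (m - i).+1%:R != 0 :> rat by rewrite pnatr_eq0.
apply: (mulIf nz); rewrite mulrAC divfK // -!natrM; congr _%:R.
rewrite mulnDl [('C(m - i, i) * _)%N]mulnC (mul_bin_diag (m - i).+1 i).
by rewrite [('C((m - i).+1, i.+1) * _)%N]mulnC -mulnDl; congr (_ * _)%N; lia.
Qed.

Lemma size_deMoivre (n : nat) (d R : rat) : (size (deMoivre_poly n d R) <= n.+1)%N.
Proof.
rewrite /deMoivre_poly (leq_trans (size_polyD _ _)) // geq_max size_polyN.
rewrite (leq_trans (size_polyC_leq1 _)) // andbT.
apply: (leq_trans (size_sum _ _ _)); apply/bigmax_leqP=> i _.
by rewrite (leq_trans (size_scale_leq _ _)) // size_polyXn ltnS leq_subr.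
Qed.

(** The homogeneous form of F_n(W + 1/W) = W^n + W^(-n), with n = 2k + 3. The term j = 0 is compared
    separately, the others through [deMoivre_coefE]. *)
Lemma horner_deMoivre (k : nat) (d R : rat) (x y : algC) :
  x * y = ratr (d ^+ 2 - R) ->
  (map_poly ratr (deMoivre_poly k.*2.+3 d R)).[x + y]
    = x ^+ k.*2.+3 + y ^+ k.*2.+3 - 2 * ratr d * ratr (d ^+ 2 - R) ^+ k.+1.
Proof.
rewrite /deMoivre_poly; set D := d ^+ 2 - R => xy.
have -> : (k.*2.+3.-1./2 = k.+1)%N by lia.
rewrite rmorphB rmorph_sum /= map_polyC /= hornerD hornerN hornerC horner_sum.
congr (_ - _); last by rewrite !rmorphM rmorph_nat rmorphXn.
rewrite -(@dickson_power_sum _ x y k.+1 k.*2.+1); last by lia.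
rewrite /dicksonU big_ord_recl [in RHS]big_ord_recl mulr_sumr -addrA -sumrB.
congr (_ + _).
  rewrite /= !bin0 !muln0 !subn0 divff ?pnatr_eq0 // !expr0 !mul1r ?mulr1 scale1r.
  by rewrite map_polyXn hornerXn.
apply: eq_bigr => i _; rewrite !lift0; have lt_ik := ltn_ord i.
rewrite deMoivre_coefE; last by lia.
rewrite linearZ /= hornerZ map_polyXn hornerXn !rmorphM rmorph_nat !rmorphXn /=.
rewrite rmorphN rmorph1 -xy natrD !exprS.
have -> : (k.*2.+3 - 2 * i.+1 = k.*2.+1 - 2 * i)%N by lia.
ring.
Qed.

(** * Roots indexed by Z/n, and the affine action of automorphisms on the indices *)

Section RootAction.

Variables (n : nat) (zeta : algC).
Hypothesis n_gt1 : (1 < n)%N.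
Hypothesis zeta_prim : n.-primitive_root zeta.

Let n_gt0 : (0 < n)%N. Proof. exact: ltnW. Qed.

Definition zexp (a : 'Z_n) : algC := zeta ^+ a.

Lemma zexp_nat (i : nat) : zexp i%:R = zeta ^+ i.
Proof. by rewrite /zexp val_Zp_nat // (prim_expr_mod zeta_prim). Qed.

Lemma zexp0 : zexp 0 = 1. Proof. exact: expr0. Qed.

Lemma zexpD a b : zexp (a + b) = zexp a * zexp b.
Proof. by rewrite -[a]natr_Zp -[b]natr_Zp -natrD !zexp_nat exprD. Qed.

Lemma zexpN a : zexp a * zexp (- a) = 1.
Proof. by rewrite -zexpD subrr zexp0. Qed.

Lemma zexpM a b : zexp (a * b) = zexp a ^+ b.
Proof. by rewrite -[a in LHS]natr_Zp -[b in LHS]natr_Zp -natrM zexp_nat exprM. Qed.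

Lemma zexp_inj : injective zexp.
Proof.
move=> a b /eqP; rewrite /zexp (eq_prim_root_expr zeta_prim) => /eqP ab.
by rewrite -[a]natr_Zp -[b]natr_Zp -Zp_nat_mod // ab Zp_nat_mod.
Qed.

Lemma zexp_root (a : 'Z_n) : zexp a ^+ n = 1.
Proof. by rewrite exprAC (prim_expr_order zeta_prim) expr1n. Qed.

Lemma aut_zexp (nu : {rmorphism algC -> algC}) (c a : 'Z_n) :
  nu zeta = zexp c -> nu (zexp a) = zexp (c * a).
Proof. by move=> nuz; rewrite rmorphXn /= nuz zexpM. Qed.

Variables (k : nat) (d R : rat) (rho alpha : algC).
Hypothesis nE : n = k.*2.+3.
Hypothesis R_nonsquare : ~ (exists r : rat, r ^+ 2 = R).
Hypothesis rho2 : rho ^+ 2 = ratr R.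

Let D : algC := ratr (d ^+ 2 - R).
Hypothesis alphaX : alpha ^+ n = D ^+ k.+1 * (ratr d + rho).

Lemma rho_neq0 : rho != 0.
Proof.
apply/eqP=> r0; case: R_nonsquare; exists 0; apply: (fmorph_inj (ratr : rat -> algC)).
by rewrite /= -rho2 r0 rmorphXn /= rmorph0.
Qed.

Lemma deMoivre_D_neq0 : D != 0.
Proof.
rewrite fmorph_eq0 subr_eq0; apply/eqP=> dR.
by case: R_nonsquare; exists d.
Qed.

Let DE : D = (ratr d + rho) * (ratr d - rho).
Proof.
transitivity (ratr d ^+ 2 - rho ^+ 2); last by ring.
by rewrite rho2 /D rmorphB rmorphXn.
Qed.

Lemma alpha_neq0 : alpha != 0.
Proof.
have D0 := deMoivre_D_neq0; apply/eqP=> al0.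
have /eqP := alphaX; rewrite al0 expr0n gtn_eqF // eq_sym mulf_eq0.
rewrite expf_eq0 (negPf D0) /= => /eqP dr0.
by case/eqP: D0; rewrite DE dr0 mul0r.
Qed.

Let beta := D / alpha.

Let alpha_beta : alpha * beta = D.
Proof. by rewrite mulrC divfK ?alpha_neq0. Qed.

Let betaX : beta ^+ n = D ^+ k.+1 * (ratr d - rho).
Proof.
apply: (mulfI (expf_neq0 n alpha_neq0)); rewrite -exprMn alpha_beta alphaX.
transitivity (D ^+ k.+1 * D ^+ k.+1 * D); last by rewrite {3}DE; ring.
by rewrite -exprD -exprSr nE; congr (_ ^+ _); lia.
Qed.

Definition deMoivre_root (a : 'Z_n) : algC := alpha * zexp a + beta * zexp (- a).

Lemma deMoivre_rootP a : root (map_poly ratr (deMoivre_poly n d R)) (deMoivre_root a).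
Proof.
apply/rootP; rewrite /deMoivre_root {1}nE horner_deMoivre; last first.
  by rewrite mulrACA zexpN mulr1 alpha_beta.
rewrite -nE [(alpha * _) ^+ n]exprMn [(beta * _) ^+ n]exprMn.
by rewrite !zexp_root !mulr1 alphaX betaX -/D; ring.
Qed.

(** From x + D/x = y + D/y follows (x - y)(x y - D) = 0. If x y = D, taking n-th powers gives (d +
    rho)^2 = D = (d + rho)(d - rho), hence rho (d + rho) = 0, impossible as R is not a square. *)
Lemma deMoivre_root_inj : injective deMoivre_root.
Proof.
have D0 := deMoivre_D_neq0; have al0 := alpha_neq0.
have z0 a : zexp a != 0 by apply/eqP=> z0; have /eqP := zexpN a; rewrite z0 mul0r eq_sym oner_eq0.
move=> a b; rewrite /deMoivre_root => eq_ab.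
have /eqP : (alpha * zexp a - alpha * zexp b) *
    (alpha * zexp a * (alpha * zexp b) - D) = 0.
  transitivity ((alpha * zexp a * (alpha * zexp b)) *
     ((alpha * zexp a + beta * zexp (- a)) - (alpha * zexp b + beta * zexp (- b)))).
    rewrite -alpha_beta.
    have -> : zexp (- a) = (zexp a)^-1 by apply: (mulfI (z0 a)); rewrite zexpN divff.
    have -> : zexp (- b) = (zexp b)^-1 by apply: (mulfI (z0 b)); rewrite zexpN divff.
    by field; rewrite !z0.
  by rewrite eq_ab subrr mulr0.
rewrite mulf_eq0 !subr_eq0 => /orP[/eqP/(mulfI al0)/zexp_inj //|/eqP eD].
have /eqP : (alpha ^+ n) ^+ 2 = D ^+ n.
  rewrite -eD !exprMn !zexp_root !mulr1; ring.
have -> : D ^+ n = D ^+ k.+1 * D ^+ k.+1 * D.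
  by rewrite -exprD -exprSr nE; congr (_ ^+ _); lia.
rewrite alphaX exprMn expr2 -subr_eq0 -mulrBr mulf_eq0 mulf_eq0 expf_eq0 (negPf D0) /=.
have -> : (ratr d + rho) ^+ 2 - D = 2 * rho * (ratr d + rho) by rewrite DE; ring.
rewrite !mulf_eq0 (negPf rho_neq0) pnatr_eq0 /= => /eqP dr0.
by case/eqP: D0; rewrite DE dr0 mul0r.
Qed.

Lemma deMoivre_roots_complete (w : algC) : deMoivre_poly n d R != 0 ->
  root (map_poly ratr (deMoivre_poly n d R)) w -> exists a, w = deMoivre_root a.
Proof.
move=> f0 fw; case: (boolP (w \in codom deMoivre_root)) => [/codomP //|w_new].
pose p := map_poly ratr (deMoivre_poly n d R) : {poly algC}.
have p0 : p != 0 by rewrite map_poly_eq0.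
have: all (root p) (w :: codom deMoivre_root).
  by rewrite /= fw; apply/allP=> _ /codomP[a ->]; apply: deMoivre_rootP.
move/(max_poly_roots p0); rewrite /= w_new.
have -> : uniq (codom deMoivre_root) by rewrite map_inj_uniq ?enum_uniq //; apply: deMoivre_root_inj.
have szc : size (codom deMoivre_root) = n by rewrite size_codom card_ord Zp_cast.
move/(_ isT); rewrite szc size_map_poly => lt_sz.
by have := leq_trans lt_sz (size_deMoivre n d R); rewrite ltnn.
Qed.

(* The sign with which [nu] acts on [rho] exchanges [alpha] and [beta], hence
   multiplies the index by -1. *)
Lemma aut_deMoivre_root (nu : {rmorphism algC -> algC}) :
  exists c b : 'Z_n, [/\ c \is a GRing.unit, nu zeta = zexp c &
    (nu rho = rho /\ forall a, nu (deMoivre_root a) = deMoivre_root (c * a + b)) \/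
    (nu rho = - rho /\ forall a, nu (deMoivre_root a) = deMoivre_root (- c * a + b))].
Proof.
have al0 := alpha_neq0.
have nuD : nu D = D by rewrite /D fmorph_rat.
have [i nu_z] : exists i : 'I_n, nu zeta = zeta ^+ i.
  have nuX : nu zeta ^+ n = 1 by rewrite -rmorphXn (prim_expr_order zeta_prim) rmorph1.
  by have [i ->] := prim_rootP zeta_prim nuX; exists i.
pose c : 'Z_n := (i : nat)%:R.
have nu_zexp a : nu (zexp a) = zexp (c * a).
  by rewrite rmorphXn /= nu_z zexpM zexp_nat.
have z0 a : zexp a != 0 by apply/eqP=> z0; have /eqP := zexpN a; rewrite z0 mul0r eq_sym oner_eq0.
(* Applied to the image of [alpha], whose n-th power is that of [alpha] or of [beta] according to
   the sign on [rho]. *)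
have shift x y : x != 0 -> y ^+ n = x ^+ n -> exists b, y = x * zexp b.
  move=> x0 yx; have [j yj] : exists j : 'I_n, y / x = zeta ^+ j.
    have yxX : (y / x) ^+ n = 1 by rewrite expr_div_n yx divff ?expf_neq0.
    by have [j ->] := prim_rootP zeta_prim yxX; exists j.
  by exists (j : nat)%:R; rewrite zexp_nat -yj mulrC divfK.
have be0 : beta != 0 by rewrite mulf_neq0 ?invr_eq0 ?deMoivre_D_neq0.
have nu_beta : nu alpha * nu beta = D by rewrite -rmorphM alpha_beta.
have uc : c \is a GRing.unit.
  rewrite unitZpE // coprime_sym -(prim_root_exp_coprime _ zeta_prim) -nu_z.
  by rewrite fmorph_primitive_root.
have : (nu rho) ^+ 2 == rho ^+ 2 by rewrite -rmorphXn /= rho2 fmorph_rat.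
rewrite eqf_sqr => /orP[]/eqP nu_rho.
  have [b nu_al] : exists b, nu alpha = alpha * zexp b.
    apply: shift => //; rewrite -rmorphXn alphaX rmorphM rmorphXn rmorphD /=.
    by rewrite nuD nu_rho fmorph_rat.
  exists c, b; split; rewrite ?zexp_nat //; left; split=> // a.
  have nu_be : nu beta = beta * zexp (- b).
    apply: (mulfI (mulf_neq0 al0 (z0 b))); rewrite -nu_al nu_beta nu_al.
    by rewrite mulrACA alpha_beta zexpN mulr1.
  rewrite /deMoivre_root rmorphD (rmorphM nu alpha) (rmorphM nu beta) /= !nu_zexp nu_al nu_be.
  by rewrite -!mulrA -!zexpD opprD mulrN (addrC b) (addrC (- b)).
have [b nu_al] : exists b, nu alpha = beta * zexp b.
  apply: shift => //; rewrite -rmorphXn alphaX betaX rmorphM rmorphXn rmorphD /=.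
  by rewrite nuD nu_rho fmorph_rat.
(* Here alpha zeta^a goes to beta zeta^(c a + b), the second summand of the root with index -(c a +
   b). *)
exists c, (- b); split; rewrite ?zexp_nat //; right; split=> // a.
have nu_be : nu beta = alpha * zexp (- b).
  apply: (mulfI (mulf_neq0 be0 (z0 b))); rewrite -nu_al nu_beta nu_al.
  by rewrite mulrACA (mulrC beta) alpha_beta zexpN mulr1.
rewrite /deMoivre_root rmorphD (rmorphM nu alpha) (rmorphM nu beta) /= !nu_zexp nu_al nu_be.
rewrite -!mulrA -!zexpD opprD !mulNr !opprK mulrN addrC.
by rewrite (addrC b) (addrC (- b)).
Qed.

End RootAction.

(** * The exceptional discriminant -3 and complex conjugation *)

(** The sign forces R' <= 0, and x is an integer because its square is. Then 3 divides x, so |R'| is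
    3 times a square, and that square is 1 by square-freeness. *)
Lemma sqfree_neg3 (R' : int) (x : rat) :
  sqfree_int R' -> x ^+ 2 = - 3%:R * R'%:~R -> R' = - 3.
Proof.
case=> R'0 sqf x2; pose a := `|numq x|%N; pose b := `|denq x|%N.
have R'le0 : R' <= 0.
  have : 0 <= x ^+ 2 by apply: sqr_ge0.
  by rewrite x2 mulNr oppr_ge0 pmulr_rle0 // lerz0.
have ab : (a ^ 2 = 3 * `|R'| * b ^ 2)%N.
  have e : numq x ^+ 2 = - 3 * R' * denq x ^+ 2.
    apply: (intr_inj (R := rat)); rewrite [LHS]rmorphXn [RHS]rmorphM rmorphM rmorphXn /=.
    rewrite -[(- 3)%:~R]/(- 3%:R : rat).
    by rewrite -x2 -exprMn -{2}[x]divq_num_den divfK // intr_eq0 denq_neq0.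
  by have := congr1 absz e; rewrite abszX abszM abszX abszM.
have b1 : b = 1%N.
  have co : coprime (a ^ 2) (b ^ 2).
    by rewrite coprime_pexpl // coprime_pexpr // coprime_num_den.
  have : (b ^ 2 %| gcdn (a ^ 2) (b ^ 2))%N by rewrite dvdn_gcd dvdnn andbT ab dvdn_mull.
  by rewrite (eqP co) dvdn1 -(exp1n 2) eqn_exp2r // => /eqP.
rewrite b1 exp1n muln1 in ab.
have : (3 %| a ^ 2)%N by rewrite ab dvdn_mulr.
rewrite Euclid_dvdX // => /andP[/dvdnP[a' ea] _].
have R'a : `|R'|%N = (3 * a' ^ 2)%N.
  by apply/eqP; rewrite -(eqn_pmul2l (isT : 0 < 3)%N) -ab ea; apply/eqP; ring.
have a'1 : a' = 1%N.
  case: a' ea R'a => [|[//|a']] ea R'a; first by rewrite -absz_eq0 R'a in R'0.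
  case/negP: (sqf _ (pdiv_prime (isT : 1 < a'.+2)%N)).
  by rewrite R'a dvdn_mull // expnS expn1 dvdn_mul ?pdiv_dvd.
by rewrite -[LHS]opprK -(ler0_norm R'le0) -abszE R'a a'1.
Qed.

(* With [r] a square root of [R'] and [w = zeta^(n/3) - zeta^(-n/3)], so that
   [w ^+ 2 = -3], the automorphism fixes [r * w] as soon as its multiplier is
   1 modulo 3. *)
Lemma eqN3_of_multipliers_1_mod3 (n : nat) (zeta r : algC) (R' : int) :
  (1 < n)%N -> (3 %| n)%N -> n.-primitive_root zeta -> sqfree_int R' ->
  r ^+ 2 = R'%:~R ->
  (forall nu : {rmorphism algC -> algC}, exists c : 'Z_n,
     nu zeta = zexp n zeta c /\
     ((nu r = r /\ (n %/ 3)%:R * (c - 1) = 0) \/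
      (nu r = - r /\ (n %/ 3)%:R * (- c - 1) = 0))) ->
  R' = - 3.
Proof.
move=> n_gt1 n3 zp sqf r2 nuP.
pose m : 'Z_n := (n %/ 3)%:R; pose E := zexp n zeta.
have ED a b : E (a + b) = E a * E b by apply: zexpD.
have E0 : E 0 = 1 by apply: zexp0.
have m3 : m + m + m = 0.
  by rewrite /m -!natrD addnn -mul2n -mulSnr mulnC divnK // pchar_Zp.
have Em1 : E m != 1.
  apply/eqP; rewrite -E0 => /(zexp_inj n zeta n_gt1 zp) /eqP.
  rewrite -val_eqE /= val_Zp_nat // => /dvdn_leq.
  by rewrite divn_gt0 // dvdn_leq ?(ltnW n_gt1) // leqNgt ltn_Pdiv ?(ltnW n_gt1) // => /(_ isT).
have ENm : E (- m) = E m ^+ 2.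
  by rewrite expr2 -ED; congr E; apply/eqP; rewrite eq_sym -addr_eq0 m3.
have Em2 : E m ^+ 2 + E m + 1 = 0.
  have nz : E m - 1 != 0 by rewrite subr_eq0.
  apply: (mulfI nz); rewrite mulr0; transitivity (E m * E m * E m - 1); first by ring.
  by rewrite -!ED m3 E0 subrr.
pose w := E m - E (- m).
have w2 : w ^+ 2 = - 3%:R.
  (* Division of (t - t^2)^2 by t^2 + t + 1 leaves remainder -3. *)
  rewrite /w ENm; transitivity ((E m ^+ 2 + E m + 1) * (E m ^+ 2 - 3%:R * E m + 3%:R) - 3%:R).
    by ring.
  by rewrite Em2 mul0r add0r.
have t2 : (r * w) ^+ 2 = ratr (- 3%:R * R'%:~R).
  by rewrite exprMn r2 w2 rmorphM rmorphN rmorph_nat /= ratr_int mulrC.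
(* The vacuous premise fits [sqrt_fixed_by_auts] at z = 0, where Q(z) = Q: the square root found is
   the rational number [q.[0]]. *)
have fix_t (nu : {rmorphism algC -> algC}) : nu 0 = 0 -> nu (r * w) = r * w.
  move=> _; have [c [nuz]] := nuP nu.
  have nuE a : nu (E a) = E (c * a) by apply: aut_zexp nuz.
  rewrite rmorphM rmorphB /= !nuE mulrN (mulrC c).
  case=> -[-> /eqP]; rewrite mulrBr mulr1 subr_eq0 => /eqP mc; first by rewrite mc.
  by rewrite -[m * c]opprK -mulrN mc opprK /w; ring.
have [q qt] := sqrt_fixed_by_auts 0 (r * w) _ t2 fix_t.
apply: (sqfree_neg3 R' q.[0]) => //.
apply: (fmorph_inj (ratr : {rmorphism rat -> algC})).
by rewrite /= -t2 -qt rmorphXn /= -horner_map /= rmorph0.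
Qed.

Lemma conj_prim_root (n : nat) (zeta : algC) : (1 < n)%N -> n.-primitive_root zeta ->
  Num.conj zeta = zexp n zeta (- 1).
Proof.
move=> n_gt1 zp; have zX := prim_expr_order zp.
have z1 : zeta * Num.conj zeta = 1.
  have /eqP : `|zeta| ^+ n = 1 by rewrite -normrX zX normr1.
  rewrite (pexpr_eq1 (ltnW n_gt1) (normr_ge0 zeta)) => /eqP nz1.
  by rewrite -normCK nz1 expr1n.
have z0 : zeta != 0 by apply/eqP=> z0; have /eqP := z1; rewrite z0 mul0r eq_sym oner_eq0.
apply: (mulfI z0); rewrite z1 -(zexpN n zeta n_gt1 zp 1); congr (_ * _).
Qed.

(** The conjugate is r or -r, and the sign is settled by the nonnegativity of r times its
    conjugate. *)
Lemma conj_sqrt (r : algC) (R' : int) : r ^+ 2 = R'%:~R ->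
  Num.conj r = (if 0 <= R' then r else - r).
Proof.
move=> r2; have : Num.conj r ^+ 2 = r ^+ 2 by rewrite -rmorphXn /= r2 rmorph_int.
move/eqP; rewrite eqf_sqr => /orP[]/eqP cr; rewrite cr; case: ifP => // R'0.
  have : 0 <= r * Num.conj r by rewrite mul_conjC_ge0.
  by rewrite cr -expr2 r2 ler0z R'0.
have : 0 <= r * Num.conj r by rewrite mul_conjC_ge0.
rewrite cr mulrN -expr2 r2 oppr_ge0 lerz0 => R'1.
have R'00 : R' = 0 by apply/eqP; rewrite eq_le R'0 R'1.
by move/eqP: r2; rewrite R'00 sqrf_eq0 => /eqP->; rewrite oppr0.
Qed.

(** * The Galois group as a group of affine maps *)

Theorem theorem1 (n : nat) (d R : rat) (s : rat) (R' : int)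
  (L : splittingFieldType rat) :
  (3 <= n)%N -> odd n -> d != 0 ->
  ~ (exists r : rat, r ^+ 2 = R) ->
  R = s ^+ 2 * R'%:~R -> sqfree_int R' ->
  splittingFieldFor 1%VS (map_poly (in_alg L) (deMoivre_poly n d R)) fullv ->
  irreducible_poly (deMoivre_poly n d R) ->
  ((3 %| n)%N -> R' != -3) ->
  ((R' < 0) /\ sqrt_in_cyclotomic n R' ->
     exists (N : {group gal_of (fullv : {vspace L})})
            (H : {group gal_of (fullv : {vspace L})}),
       [/\ (N ><| H)%g = 'Gal(fullv / 1%VS)%g,
           (N \isog Zp n)%g &
           (H \isog (units_Zp n / <<pm1_units n>>))%g])
  /\
  (~ ((R' < 0) /\ sqrt_in_cyclotomic n R') ->
     exists (N : {group gal_of (fullv : {vspace L})})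
            (H : {group gal_of (fullv : {vspace L})}),
       [/\ (N ><| H)%g = 'Gal(fullv / 1%VS)%g,
           (N \isog Zp n)%g &
           (H \isog units_Zp n)%g]).
Proof.
move=> n_ge3 n_odd _ Rns RE sqf splitL irrf neq3.
have [k nE] : exists k, n = k.*2.+3 by exists (n - 3)./2; lia.
have n_gt1 : (1 < n)%N by apply: leq_trans n_ge3.
have n_gt0 : (0 < n)%N by apply: ltnW.
have [zeta zp] := C_prim_root_exists n_gt0.
pose r : algC := sqrtC R'%:~R; have r2 : r ^+ 2 = R'%:~R by apply: sqrtCK.
pose rho : algC := ratr s * r.
have rho2 : rho ^+ 2 = ratr R by rewrite exprMn r2 RE rmorphM rmorphXn /= ratr_int.
have s0 : s != 0.
  by apply/eqP=> s0; case: Rns; exists 0; rewrite RE s0 expr0n mul0r.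
have r0 : r != 0.
  by rewrite -sqrf_eq0 r2 intr_eq0; case: sqf.
have r_neqN : r <> - r.
  by move/eqP; rewrite -addr_eq0 -mulr2n mulrn_eq0 (negPf r0).
pose D : algC := ratr (d ^+ 2 - R).
pose alpha : algC := n.-root (D ^+ k.+1 * (ratr d + rho)).
have alphaX : alpha ^+ n = D ^+ k.+1 * (ratr d + rho) by apply: rootCK.
pose u := deMoivre_root n zeta d R alpha.
have uP a : root (map_poly ratr (deMoivre_poly n d R)) (u a).
  exact: (deMoivre_rootP n zeta n_gt1 zp k d R rho alpha).
have u_inj : injective u.
  exact: (deMoivre_root_inj n zeta n_gt1 zp k d R rho alpha).
have f0 : deMoivre_poly n d R != 0.
  by rewrite -size_poly_gt0; case: irrf => sz _; apply: ltnW.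
have u_all w : root (map_poly ratr (deMoivre_poly n d R)) w -> exists a, w = u a.
  exact: (deMoivre_roots_complete n zeta n_gt1 zp k d R rho alpha).
have [e] := num_field_to_algC L.
have [rs f_rs rs_gen] := splitL.
have ef : map_poly e (map_poly (in_alg L) (deMoivre_poly n d R))
    = map_poly ratr (deMoivre_poly n d R).
  rewrite -map_poly_comp; apply: eq_map_poly => a.
  by rewrite /= rmorphZ_num rmorph1 mulr1.
have e_rs w : (root (map_poly ratr (deMoivre_poly n d R)) w) = (w \in map e rs).
  rewrite -ef -(eqp_root (_ : map_poly e (\prod_(z <- rs) ('X - z%:P)) %= _)).
    rewrite rmorph_prod /= -root_prod_XsubC big_map; congr (root _ w).
    by apply: eq_bigr => z _; rewrite map_polyXsubC.
  by rewrite eqp_map eqp_sym.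
have v_ex a : {x : L | e x = u a}.
  by have := uP a; rewrite e_rs => /mapP/sig2_eqW[x _ ->]; exists x.
pose v a : L := sval (v_ex a).
have ev a : e (v a) = u a by rewrite /v; case: (v_ex a).
have v_inj : injective v by move=> a b ab; apply: u_inj; rewrite -!ev ab.
have rs_v x : x \in rs -> exists a, x = v a.
  move=> rs_x; have [|a ea] := u_all (e x); first by rewrite e_rs map_f.
  by exists a; apply: (fmorph_inj e); rewrite ea ev.
pose G := ('Gal({:L} / 1%VS))%G.
(* Since rho = s r with s rational and nonzero, the sign on [rho] is also the sign on [r]. *)
have autP (nu : {rmorphism algC -> algC}) : exists c b : 'Z_n, [/\ c \is a GRing.unit, nu zeta = zexp n zeta c &
    (nu r = r /\ forall a, nu (u a) = u (c * a + b)) \/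
    (nu r = - r /\ forall a, nu (u a) = u (- c * a + b))].
  have [c [b [uc nuz nuP]]] :=
    aut_deMoivre_root n zeta n_gt1 zp k d R rho alpha nE Rns rho2 alphaX nu.
  have nu_rho : nu rho = ratr s * nu r by rewrite rmorphM fmorph_rat.
  have s0' : ratr s != 0 :> algC by rewrite fmorph_eq0.
  exists c, b; split=> //; case: nuP => -[nur nuu]; [left|right]; split=> //.
    by apply: (mulfI s0'); rewrite -nu_rho nur.
  by apply: (mulfI s0'); rewrite -nu_rho nur mulrN.
(* The boolean quantifier allows [sigW] to pick the multiplier and displacement as functions of g;
   [aff_inj] below shows that they are unique, whence the composition rules. *)
have gal_aff (g : gal_of {:L}) :
    {cb : {unit 'Z_n} * 'Z_n | [forall a, g (v a) == v (val cb.1 * a + cb.2)]}.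
  apply: sigW; have [nu nuE] := gal_to_algC_aut L e g.
  have [c [b [uc _ nuP]]] := autP nu.
  have gvE c' : (forall a, nu (u a) = u (c' * a + b)) ->
      forall a, g (v a) = v (c' * a + b).
    by move=> nuu a; apply: (fmorph_inj e); rewrite -nuE !ev.
  case: nuP => -[_ /gvE gv].
    by exists (FinRing.unit 'Z_n uc, b); apply/forallP=> a; rewrite gv.
  have uNc : - c \is a GRing.unit by rewrite unitrN.
  by exists (FinRing.unit 'Z_n uNc, b); apply/forallP=> a; rewrite gv.
pose mu g := (sval (gal_aff g)).1; pose tr g := (sval (gal_aff g)).2.
have muP (g : gal_of {:L}) a : g (v a) = v (val (mu g) * a + tr g).
  by rewrite /mu /tr; case: (gal_aff g) => cb /= /forallP/(_ a)/eqP.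
have aff_inj (c b c' b' : 'Z_n) :
    (forall a, v (c * a + b) = v (c' * a + b')) -> c = c' /\ b = b'.
  move=> vv; have bb : b = b'.
    by have /v_inj := vv 0; rewrite !mulr0 !add0r.
  by have /v_inj := vv 1; rewrite !mulr1 bb => /addIr.
have muM' (g h : gal_of {:L}) : val (mu (g * h)%g) = val (mu g) * val (mu h) /\
    tr (g * h)%g = tr g * val (mu h) + tr h.
  apply: aff_inj => a; rewrite -muP galM ?memvf // !muP; congr v; ring.
have muM : {in G &, {morph mu : g h / (g * h)%g >-> (g * h)%g}}.
  by move=> g h _ _; apply: val_inj; have [] := muM' g h.
have trM : {in G &, forall g h, tr (g * h)%g = tr g * val (mu h) + tr h}.
  by move=> g h _ _; have [] := muM' g h.
have faithful : {in G, forall g, mu g = 1%g -> tr g = 0 -> g = 1%g}.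
  move=> g _ mg tg; apply/eqP/gal_eqP=> x _; rewrite gal_id.
  apply/fixedSpaceP; apply: (subvP _ _ (memvf x)); rewrite -rs_gen.
  apply/(@Fadjoin_seqP _ _ 1%AS _ (fixedSpace_aspace g)); split; first exact: sub1v.
  move=> y /rs_v[a ->]; apply/fixedSpaceP.
  by rewrite muP mg tg /= mul1r addr0.
have trans j : exists2 g, g \in G & tr g = j.
  have root_v a : root (map_poly (in_alg L) (deMoivre_poly n d R)) (v a).
    by rewrite -(fmorph_root e) ef ev uP.
  (* By irreducibility the minimal polynomial of [v 0] is f_n up to a scalar, so [v j] is a
     conjugate of [v 0]; and g sends [v 0] to [v (tr g)]. *)
  have : root (minPoly 1 (v 0)) (v j).
    have /polyOver1P[q Dq] := minPolyOver 1 (v 0).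
    have qf : q %= deMoivre_poly n d R.
      case: irrf => _; apply.
        rewrite -(size_map_poly (in_alg L)) -Dq gtn_eqF //.
        by apply: root_size_gt1 (root_minPoly 1 _); rewrite monic_neq0 ?monic_minPoly.
      by rewrite -(dvdp_map (in_alg L)) -Dq minPoly_dvdp ?alg_polyOver.
    by rewrite Dq (eqp_root (_ : _ %= map_poly (in_alg L) (deMoivre_poly n d R))) ?eqp_map.
  case/(normalField_root_minPoly (sub1v _) (normalFieldf 1) (memvf _)) => g Gg gv.
  by exists g => //; apply: v_inj; rewrite -gv muP mulr0 add0r.
have nu_gal (nu : {rmorphism algC -> algC}) : exists2 g, g \in G &
    exists c : 'Z_n, [/\ c \is a GRing.unit, nu zeta = zexp n zeta c &
    (nu r = r /\ val (mu g) = c) \/ (nu r = - r /\ val (mu g) = - c)].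
  have [g Gg gE] := algC_aut_to_gal L e nu; exists g => //.
  have [c [b [uc nuz nuP]]] := autP nu; exists c; split=> //.
  have vE c' : (forall a, nu (u a) = u (c' * a + b)) -> val (mu g) = c'.
    move=> nuu; have [] // : val (mu g) = c' /\ tr g = b.
    by apply: aff_inj => a; rewrite -muP; apply: (fmorph_inj e); rewrite -gE !ev.
  by case: nuP => -[nur /vE mg]; [left|right].
have gal_nu (g : gal_of {:L}) : exists nu : {rmorphism algC -> algC},
    exists c : 'Z_n, nu zeta = zexp n zeta c /\
    ((nu r = r /\ val (mu g) = c) \/ (nu r = - r /\ val (mu g) = - c)).
  have [nu nuE] := gal_to_algC_aut L e g; exists nu.
  have [c [b [uc nuz nuP]]] := autP nu; exists c; split=> //.
  have vE c' : (forall a, nu (u a) = u (c' * a + b)) -> val (mu g) = c'.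
    move=> nuu; have [] // : val (mu g) = c' /\ tr g = b.
    by apply: aff_inj => a; rewrite -muP; apply: (fmorph_inj e); rewrite -nuE !ev.
  by case: nuP => -[nur /vE mg]; [left|right].
have z_inj := zexp_inj n zeta n_gt1 zp.
have mu_pm c : c \is a GRing.unit ->
    exists2 g, g \in G & val (mu g) = c \/ val (mu g) = - c.
  move=> uc; have co : coprime c n.
    by rewrite coprime_sym -unitZpE // natr_Zp.
  have [nu nuE] := Qn_aut_exists co; have [g Gg [c' [_ nuz nuP]]] := nu_gal nu.
  have cc : c' = c.
    by apply: z_inj; rewrite -nuz nuE ?(prim_expr_order zp).
  by exists g => //; rewrite cc in nuP; case: nuP => -[_ ->]; [left|right].
have mu3 : (3 %| n)%N ->
    exists2 g, g \in G & (n %/ 3)%:R * (val (mu g) - 1) != 0.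
  move=> n3; apply/exists_inP; apply: contraT => /exists_inPn no_g.
  case/eqP: (neq3 n3); apply: (eqN3_of_multipliers_1_mod3 n zeta r R' n_gt1 n3 zp sqf r2) => nu.
  have [g Gg [c [_ nuz nuP]]] := nu_gal nu; exists c; split=> //.
  have /eqP := negbNE (no_g _ Gg).
  by case: nuP => -[nur ->] mg; [left|right].
pose muf := Morphism muM.
have noN1 : ~ (exists2 g, g \in G & val (mu g) = -1) ->
    R' < 0 /\ sqrt_in_cyclotomic n R'.
  move=> no_g; split.
    rewrite ltNge; apply/negP=> R'0; case: no_g.
    have [g Gg [c [_ nuz nuP]]] := nu_gal Num.conj; exists g => //.
    rewrite /= (conj_prim_root n zeta n_gt1 zp) in nuz.
    rewrite /= (conj_sqrt r R' r2) R'0 in nuP.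
    case: nuP => -[rr mg]; last by case: (r_neqN rr).
    by apply: (etrans mg); apply: z_inj.
  exists zeta; split=> //.
  apply: (sqrt_fixed_by_auts zeta r R'%:~R); first by rewrite ratr_int.
  move=> nu nuz1; have [g Gg [c [_ nuz nuP]]] := nu_gal nu.
  have c1 : c = 1.
    by apply: z_inj; rewrite -nuz nuz1.
  case: nuP => -[// _ mg]; case: no_g; exists g => //.
  by apply: (etrans mg); rewrite c1.
(* Suppose the multiplier is -1. If [nu] fixes r, then c = -1, so [nu] agrees with conjugation on
   Q(zeta), which contains r, yet conjugation negates r. If [nu] negates r, then c = 1 and [nu]
   fixes Q(zeta), hence r. *)
have hasN1 : R' < 0 /\ sqrt_in_cyclotomic n R' ->
    ~ (exists2 g, g \in G & val (mu g) = -1).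
  case=> R'0 [z [zz [q qz]]] [g Gg mg].
  have [nu [c [nuz nuP]]] := gal_nu g.
  (* The primitive root [z] of the hypothesis may differ from [zeta], but is a power of it. *)
  have [i zi] := prim_rootP zp (prim_expr_order zz).
  have nur (nu' : {rmorphism algC -> algC}) : nu' r = (map_poly ratr q).[nu' z].
    rewrite /r -qz -horner_map -map_poly_comp; congr _.[_].
    by apply: eq_map_poly => a /=; rewrite fmorph_rat.
  case: nuP => -[nu_r c1]; have {}c1 := etrans (esym mg) c1.
    have : nu r = Num.conj r.
      rewrite !nur zi !rmorphXn /= nuz -c1.
      by rewrite (conj_prim_root n zeta n_gt1 zp).
    by rewrite nu_r (conj_sqrt r R' r2) leNgt R'0.
  have : nu r = r.
    have nuz1 : nu zeta = zeta.
      by rewrite nuz -[c]opprK -c1 opprK.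
    by rewrite nur zi rmorphXn /= nuz1 -zi qz.
  by rewrite nu_r => /esym.
split=> [in_cyc|not_in].
  apply: (affine_sdprod_units_mod_pm1 n _ G muf tr) => //.
  exact: hasN1.
apply: (affine_sdprod_units n _ G muf tr) => //.
(* Existence in a finite group is decidable, so [noN1] can be used contrapositively. *)
have : [exists g in G, val (mu g) == -1].
  apply: contraT => /exists_inPn no_g; case: not_in; apply: noN1 => -[g Gg mg].
  by have := no_g g Gg; rewrite mg eqxx.
by case/exists_inP=> g Gg /eqP mg; exists g.
Qed.
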